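(* Let $r\in\mathbb N$, $0<\alpha\le r$, and $\gamma\ge0$. There is a constant $C$ such that for every $f\in C^r(I)$, $I=[0,1]$, and every $n\in\mathbb N$ with $n\ge r^2+1$ $$\|f-B_n(f)\|_{C^{r,\alpha}}\le\frac1{n^{\gamma(r-\alpha)}}\left(C\,\omega_2^\varphi\Big(f^{(r)},\frac1{\sqrt n}\Big)+\omega_1\Big(f^{(r)},\frac rn\Big)+\frac{(r-1)^2}{n}\|f^{(r)}\|\right)+C\,n^{\gamma\alpha}\,\omega_2^\varphi\Big(f,\frac1{\sqrt n}\Big)$$ ($C$ is independent of $f$ and $n$).
   Context: $I=[0,1]$, $\varphi(x)=\sqrt{x(1-x)}$, $\|f\|=\max_{x\in I}|f(x)|$. The Bernstein operators are $B_n(f,x)=\sum_{k=0}^nf(\tfrac kn)\binom nkx^k(1-x)^{n-k}$. The Ditzian-Totik modulus is $\omega_2^\varphi(f,\delta)=\sup_{|h|\le\delta}\|\Delta_{h\varphi}^2f\|$, where for a function $\psi$ and $r\in\mathbb N$, $\Delta_{h\psi(x)}^rf(x)=\sum_{k=0}^r(-1)^k\binom rkf\big(x+(\tfrac r2-k)h\psi(x)\big)$ if $x\pm\frac r2h\psi(x)\in I$, and $0$ otherwise (norms of differences are suprema over $x\in I$). $\Delta_h^r$ is the difference obtained with $\psi\equiv1$. $\omega_1(f,h)=\sup\{|f(x)-f(y)|:\ |x-y|<h,\ x,y\in I\}$. The classical Hölder norm is $\|f\|_{C^{r,\alpha}}=\|f\|+\sup_{0<h<1}h^{-\alpha}\|\Delta_h^rf\|$.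 *)

(* Defs.v *)
From HB Require Import structures.
From mathcomp Require Import all_boot all_order all_algebra.
From mathcomp Require Import all_classical all_reals all_analysis.

Set Implicit Arguments.
Unset Strict Implicit.
Unset Printing Implicit Defensive.

Import Order.TTheory GRing.Theory Num.Theory.
Import numFieldNormedType.Exports.

Local Open Scope classical_set_scope.
Local Open Scope ring_scope.

(* Functions on I = [0, 1] are represented by functions R -> R, of which only
   the values on I are ever used.  Suprema are taken in \bar R, so that a
   supremum of an unbounded set is +oo rather than a default value. *)

Section defs.
Context {R : realType}.
Implicit Types (f psi : R -> R) (x h d a : R) (n r k : nat).

Definition I01 : set R := `[0, 1].

(* The limit is relative to I, hence one-sided at the endpoints. *)
Definition diff_quot f x : R -> R := fun y => (f y - f x) / (y - x).

Definition derivableI f x : Prop :=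
  cvg (diff_quot f x @ within I01 x^').

Definition derivI f : R -> R :=
  fun x => lim (diff_quot f x @ within I01 x^').

Definition derivIn r f : R -> R := iter r derivI f.

Definition CI r f : Prop :=
  (forall k, (k < r)%N -> forall x, I01 x -> derivableI (derivIn k f) x)
  /\ {within I01, continuous (derivIn r f)}.

(* This is max_I |f| when f is continuous on I. *)
Definition normI f : \bar R := ereal_sup [set `|f x|%:E | x in I01].

Definition phi x : R := Num.sqrt (x * (1 - x)).

Definition bernstein n f : R -> R := fun x =>
  \sum_(k < n.+1) f (k%:R / n%:R) * 'C(n, k)%:R * x ^+ k * (1 - x) ^+ (n - k).

Definition symdiff r h psi f : R -> R := fun x =>
  if (x + r%:R / 2 * (h * psi x) \in `[0, 1]) &&
     (x - r%:R / 2 * (h * psi x) \in `[0, 1])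
  then \sum_(k < r.+1)
         (-1) ^+ k * 'C(r, k)%:R * f (x + (r%:R / 2 - k%:R) * (h * psi x))
  else 0.

Definition omega2_phi f d : \bar R :=
  ereal_sup [set normI (symdiff 2 h phi f) | h in [set h | `|h| <= d]].

Definition omega1 f d : \bar R :=
  ereal_sup [set e | exists x y,
    [/\ I01 x, I01 y, `|x - y| < d & e = `|f x - f y|%:E]].

Definition holder_norm r a f : \bar R :=
  (normI f + ereal_sup [set (h `^ (- a))%:E * normI (symdiff r h (cst 1%R) f)
                       | h in [set h : R | (0 < h < 1)%R]])%E.

End defs.

(* Main.v *)
Require Import Defs.
From HB Require Import structures.
From mathcomp Require Import all_boot all_order all_algebra.
From mathcomp Require Import all_classical all_reals all_analysis.
From mathcomp Require Import ring lra zify.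

Set Implicit Arguments.
Unset Strict Implicit.
Unset Printing Implicit Defensive.

Import Order.TTheory GRing.Theory Num.Theory.
Import numFieldNormedType.Exports.

Local Open Scope classical_set_scope.
Local Open Scope ring_scope.

(** Let g = f - B_n f, omega_phi(f) = omega_2^phi(f, 1/sqrt n) and
    t = n^(-gamma).  In the Hoelder seminorm of g a difference of step h <= t is
    at most h^r ||g^(r)|| by the mean value theorem, and one of step h > t is at
    most 2^r ||g||.  Multiplying by h^(-alpha) turns these bounds into
    t^(r - alpha) ||g^(r)|| and t^(-alpha) 2^r ||g||, the two powers of n of the
    statement ([holder_norm_le]).  It remains to estimate ||g|| and ||g^(r)||.

    Estimate of ||g||.  The claim is |f - B_m f| <= 9 omega_phi(f) for every m
    with n <= 2 m ([bern_approx]).  The proof compares f with convex functions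
    and uses no smoothing of f.  Put psi(t) = t ln t + (1 - t) ln (1 - t), so
    that psi'' = 1/phi^2, and let W >= omega_phi(f) be positive.
    - The second difference of psi at y with step phi(y)/sqrt n is at least
      1/(2n) ([entropy_second_diff]), so that of F = f + 4 n W psi is at least
      2 W - W > 0.
    - Hence F is convex up to an error W: on [a, b] let E be F minus its chord
      and y a maximum point of E.  If the step phi(y)/sqrt n fits into [a, b],
      the second difference of E at y would be both <= 0 and > 0.  Otherwise a
      shorter step reaches an endpoint, where E = 0, and the second difference
      there, which is at least - W and at most - E(y), gives E(y) <= W
      ([second_diff_max], [entropy_near_convex]).
    - So some line lies below F on [0, 1] and passes W below F(x)
      ([near_convex_support]).  As B_m is positive and preserves lines,
      B_m F(x) >= F(x) - W ([near_convex_jensen]).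
    - The inequality ln z <= z - 1 gives B_m psi - psi <= 1/m ([bern_entropy]),
      so the correction 4 n W psi costs at most 4 n W / m <= 8 W.
    Applying this to f and to - f gives the claim.

    Estimate of ||g^(r)||.  The r-th derivative of B_n f is n(n-1)...(n-r+1)
    times the Bernstein operator of degree n - r applied to the r-th differences
    of k |-> f(k/n); by the mean value theorem these are n^(-r) f^(r)(xi_k) with
    k/n < xi_k < (k + r)/n.  Since k/(n - r) lies in the same interval, moving
    xi_k there costs omega_1(f^(r), r/n); replacing the factor
    n(n-1)...(n-r+1)/n^r by 1 costs (r - 1)^2/n ||f^(r)||; and what is left is
    f^(r) - B_(n-r) f^(r), to which the first estimate applies because
    n <= 2 (n - r) ([bern_deriv_approx]). *)

(** * Bernstein polynomials by the de Casteljau recursion *)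

Section casteljau.
Context {R : realType}.
Implicit Types (a b x : R) (c d : nat -> R) (m k : nat).

(** The weights (1 - x, x) give Bernstein polynomials and (1, -1) give iterated
    differences, so one binomial expansion serves both; positivity, moments and
    derivatives follow from the recursion by induction on the degree. *)
Fixpoint casteljau a b m c : R :=
  if m is m'.+1 then a * casteljau a b m' c + b * casteljau a b m' (c \o S)
  else c 0%N.

Lemma casteljauE a b m c : casteljau a b m c =
  \sum_(k < m.+1) c k * 'C(m, k)%:R * b ^+ k * a ^+ (m - k).
Proof.
elim: m c => [|m IH] c /=.
  by rewrite big_ord_recl big_ord0 bin0 !expr0 !mulr1 addr0.
rewrite !IH.
rewrite [in RHS]big_ord_recl /= bin0 subn0 expr0.
under [in RHS]eq_bigr => i _ do
  rewrite /bump /= add1n subSS binS natrD mulrDr !mulrDl.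
rewrite big_split /= [in RHS]big_ord_recr /= bin_small // mulr0 !mul0r addr0.
rewrite [X in a * X]big_ord_recl /= mulrDr.
rewrite bin0 expr0 subn0 -!addrA; congr (_ + _); first by rewrite exprS; ring.
congr (_ + _); last first.
  rewrite mulr_sumr; apply: eq_bigr => i _ /=.
  by rewrite exprS; ring.
rewrite mulr_sumr; apply: eq_bigr => i _ /=.
by rewrite /bump /= add1n -[(m - i)%N](@subnSK) // [a ^+ _.+1]exprS; ring.
Qed.

Lemma casteljauDl a b m c d (k l : R) :
  casteljau a b m (fun i => k * c i + l * d i)
  = k * casteljau a b m c + l * casteljau a b m d.
Proof.
elim: m c d => [//|m IH] c d /=; rewrite IH.
have := IH (c \o S) (d \o S); rewrite /comp => ->; ring.
Qed.

Lemma eq_casteljau a b m c d :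
  (forall k, (k <= m)%N -> c k = d k) -> casteljau a b m c = casteljau a b m d.
Proof.
elim: m c d => [|m IH] c d cd /=; first exact: cd.
by congr (_ * _ + _ * _); apply: IH => k km; apply: cd => //; exact: leqW.
Qed.

Definition bern m c x := casteljau (1 - x) x m c.

Lemma bernsteinE m (f : R -> R) x :
  bernstein m f x = bern m (fun k => f (k%:R / m%:R)) x.
Proof. by rewrite /bern casteljauE. Qed.

Lemma le_bern m c d x : 0 <= x <= 1 ->
  (forall k, (k <= m)%N -> c k <= d k) -> bern m c x <= bern m d x.
Proof.
move=> /andP[x0 x1]; rewrite /bern.
elim: m c d => [|m IH] c d cd /=; first exact: cd.
apply: lerD; apply: ler_wpM2l; rewrite ?subr_ge0 //; apply: IH => k km;
  apply: cd => //; exact: leqW.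
Qed.

Lemma bern_cst m (a : R) x : bern m (fun=> a) x = a.
Proof.
by rewrite /bern; elim: m => [//|m IH] /=; rewrite /comp /= IH; ring.
Qed.

Lemma ler_norm_bern m c (K : R) x : 0 <= x <= 1 ->
  (forall k, (k <= m)%N -> `|c k| <= K) -> `|bern m c x| <= K.
Proof.
move=> x01 cK; rewrite ler_norml; apply/andP; split.
  rewrite -[leLHS](bern_cst m _ x); apply: le_bern => // k /cK.
  by rewrite ler_norml => /andP[].
rewrite -[leRHS](bern_cst m _ x); apply: le_bern => // k /cK.
by rewrite ler_norml => /andP[].
Qed.

Lemma bernS m c x : bern m.+1 c x = (1 - x) * bern m c x + x * bern m (c \o S) x.
Proof. by []. Qed.

Lemma bern_lin m c d (k l : R) x :
  bern m (fun i => k * c i + l * d i) x = k * bern m c x + l * bern m d x.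
Proof. exact: casteljauDl. Qed.

Lemma bern_nat m x : bern m (fun k => k%:R) x = m%:R * x.
Proof.
elim: m => [|m IH]; first by rewrite mul0r.
rewrite bernS IH.
rewrite (_ : (fun _ => _) \o S = fun k => 1 * k%:R + 1 * 1); last first.
  by apply/funext => k /=; rewrite -natr1 !mul1r.
by rewrite bern_lin bern_cst IH -natr1; ring.
Qed.

Lemma bern_sqr m x :
  bern m (fun k => k%:R ^+ 2) x = m%:R * (x * (1 - x)) + (m%:R * x) ^+ 2.
Proof.
elim: m => [|m IH]; first by rewrite !mul0r expr0n /= addr0 /bern /= expr0n.
rewrite bernS IH.
rewrite (_ : (fun _ => _) \o S = fun k => 1 * k%:R ^+ 2 + 1 * (2 * k%:R + 1 * 1));
  last by apply/funext => k /=; rewrite -natr1; ring.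
rewrite !bern_lin bern_cst bern_nat IH -natr1; ring.
Qed.

Lemma bern_node m x : (0 < m)%N -> bern m (fun k => k%:R / m%:R) x = x.
Proof.
move=> m0; have mR : m%:R != 0 :> R by rewrite pnatr_eq0 -lt0n.
rewrite (_ : (fun _ => _) = fun k => m%:R^-1 * k%:R + 0 * 1); last first.
  by apply/funext => k; rewrite mul0r addr0 mulrC.
by rewrite bern_lin bern_nat; field.
Qed.

Lemma bern_node_sqr m x : (0 < m)%N ->
  bern m (fun k => (k%:R / m%:R) ^+ 2) x = x * (1 - x) / m%:R + x ^+ 2.
Proof.
move=> m0; have mR : m%:R != 0 :> R by rewrite pnatr_eq0 -lt0n.
rewrite (_ : (fun _ => _) = fun k => m%:R^-2 * k%:R ^+ 2 + 0 * 1); last first.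
  by apply/funext => k; rewrite mul0r addr0 expr_div_n mulrC.
by rewrite bern_lin bern_sqr; field.
Qed.

Definition diffs c : nat -> R := fun k => c k.+1 - c k.

(** In the inductive step the product rule leaves the factors 1 - x and x in
    front of the two lower derivatives, and these recombine into the recursion
    for the difference sequence. *)
Lemma is_derive_bern m c x : is_derive x 1 (bern m c) (m%:R * bern m.-1 (diffs c) x).
Proof.
elim: m c => [|m IH] c; first by rewrite mul0r /bern /=; exact: is_derive_cst.
rewrite (_ : bern m.+1 c = (cst 1 - id) * bern m c + id * bern m (c \o S)) //.
pose proof (IH c); pose proof (IH (c \o S)).
apply: is_derive_eq.
rewrite /=.
have -> : diffs (c \o S) = diffs c \o S by [].
have E1 : bern m (diffs c) x = bern m (c \o S) x - bern m c x.
  have := bern_lin m (c \o S) c 1 (-1) x; rewrite mul1r mulN1r => <-.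
  by congr bern; apply/funext => k /=; rewrite mul1r mulN1r.
have E2 : m%:R * bern m (diffs c) x = m%:R * ((1 - x) * bern m.-1 (diffs c) x
   + x * bern m.-1 (diffs c \o S) x).
  by case: m {IH H H0 E1} => [|m]; rewrite ?mul0r.
rewrite -natr1 mulrDl mul1r E2 E1 /GRing.scale /= !fctE /=.
ring.
Qed.
End casteljau.

(** * The entropy function *)

Section entropy.
Context {R : realType}.
Implicit Types (x t s : R) (m k : nat).

Definition xlnx t := t * ln t.

Lemma ln_le_subr1 t : 0 < t -> ln t <= t - 1.
Proof.
move=> t0; have := @le_ln1Dx R (t - 1).
by rewrite (_ : 1 + (t - 1) = t); [apply; lra|ring].
Qed.

(** This is ln (t / x) <= t / x - 1.  The bound is quadratic in t, so the
    Bernstein operator of its right-hand side is known exactly. *)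
Lemma xlnx_le_quadratic x t : 0 < x -> 0 <= t ->
  xlnx t <= t * (ln x - 1) + t ^+ 2 / x.
Proof.
move=> x0; rewrite le_eqVlt => /predU1P[<-|t0].
  by rewrite /xlnx expr0n /= !mul0r addr0.
have := ln_le_subr1 (divr_gt0 t0 x0); rewrite ln_div ?posrE// => h.
rewrite (_ : _ + _ = t * (ln x + (t / x - 1))); last by field; lra.
by rewrite /xlnx ler_pM2l//; lra.
Qed.

(** This is ln z <= z - 1 at z = sqrt (x / t).  Using z = x / t instead would
    only give the tangent line of xlnx; the square root keeps a term that is
    strictly convex in t, which yields a quadratic gain in the next lemma. *)
Lemma xlnx_ge_sqrt x t : 0 < x -> 0 <= t ->
  t * ln x + 2 * t - 2 * Num.sqrt (x * t) <= xlnx t.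
Proof.
move=> x0; rewrite le_eqVlt => /predU1P[<-|t0].
  by rewrite /xlnx !mulr0 sqrtr0 !mul0r mulr0; lra.
have s0 : 0 < Num.sqrt (x * t) / t by rewrite divr_gt0// sqrtr_gt0 mulr_gt0.
have := ln_le_subr1 s0.
have := lnXn 2 s0.
rewrite expr_div_n sqr_sqrtr; last by rewrite mulr_ge0// ltW.
rewrite (_ : x * t / t ^+ 2 = x / t); last by field; lra.
rewrite ln_div ?posrE// mulr2n => h1 h2.
have h3 : ln x - ln t <= 2 * (Num.sqrt (x * t) / t - 1) by lra.
move: h3; rewrite -(ler_pM2l t0) /xlnx.
rewrite (_ : t * (2 * _) = 2 * Num.sqrt (x * t) - 2 * t); last by field; lra.
lra.
Qed.

Lemma xlnx_second_diff x s : 0 < x -> 0 <= x - s -> 0 <= x + s ->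
  s ^+ 2 / x / 2 <= xlnx (x + s) + xlnx (x - s) - 2 * xlnx x.
Proof.
move=> x0 xs xs'.
have := xlnx_ge_sqrt x0 xs; have := xlnx_ge_sqrt x0 xs'.
set p := Num.sqrt (x * (x + s)); set q := Num.sqrt (x * (x - s)).
have p0 : 0 <= p by exact: sqrtr_ge0.
have q0 : 0 <= q by exact: sqrtr_ge0.
have p2 : p ^+ 2 = x * (x + s) by rewrite sqr_sqrtr// mulr_ge0// ltW.
have q2 : q ^+ 2 = x * (x - s) by rewrite sqr_sqrtr// mulr_ge0// ltW.
have s2x : s ^+ 2 <= x ^+ 2 by nra.
have pq : p * q <= x ^+ 2 - s ^+ 2 / 2.
  rewrite -(@ler_pXn2r _ 2)// ?nnegrE ?mulr_ge0//; last by nra.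
  by rewrite exprMn p2 q2; have := sqr_ge0 (s ^+ 2); lra.
have h : p + q <= 2 * x - s ^+ 2 / x / 4.
  have sx : s ^+ 2 / x <= x by rewrite ler_pdivrMr// -expr2.
  rewrite -(@ler_pXn2r _ 2)// ?nnegrE; [|lra|lra].
  have -> : (p + q) ^+ 2 = p ^+ 2 + q ^+ 2 + 2 * (p * q) by ring.
  have -> : (2 * x - s ^+ 2 / x / 4) ^+ 2
          = 4 * x ^+ 2 - s ^+ 2 + (s ^+ 2 / x / 4) ^+ 2 by field; lra.
  rewrite p2 q2; have := sqr_ge0 (s ^+ 2 / x / 4); lra.
rewrite /xlnx; lra.
Qed.

Lemma norm_xlnx_le t : t <= 1 -> `|xlnx t| <= 2 * Num.sqrt t.
Proof.
move=> t1; have [t0|t0] := leP t 0.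
  by rewrite /xlnx ln0// mulr0 normr0 mulr_ge0// sqrtr_ge0.
have h0 : xlnx t <= 0 by rewrite /xlnx mulr_ge0_le0 ?ln_le0// ltW.
rewrite ler0_norm//.
have := @xlnx_ge_sqrt 1 t ltr01 (ltW t0).
rewrite ln1 mul1r; lra.
Qed.

Lemma continuous_xlnx : continuous xlnx.
Proof.
move=> t; have [t0|t0|->] := ltrgtP t 0.
- apply: (@near_cst_continuous _ _ 0); near=> u.
  rewrite /xlnx ln0 ?mulr0// ltW//.
  by near: u; exact: lt_nbhsl.
- by apply: cvgM; [exact: cvg_id|exact: continuous_ln].
- have s0 : 2 * Num.sqrt u @[u --> (0:R)] --> (0:R).
    rewrite -[X in _ --> X](mulr0 2); apply: cvgMl_tmp.
    by rewrite -[X in _ --> X]sqrtr0; exact: sqrt_continuous.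
  rewrite /continuous_at [xlnx 0]mul0r.
  apply: (@squeeze_cvgr _ _ _ _ (fun u => - (2 * Num.sqrt u))
     (fun u => 2 * Num.sqrt u)) => //.
    near=> u; rewrite -ler_norml norm_xlnx_le// ltW//.
    by near: u; exact: lt_nbhsl.
  by rewrite -[X in _ --> X]oppr0; exact: cvgN.
Unshelve. all: by end_near. Qed.

(** The negative of the binary entropy.  Its second derivative is 1 / phi^2,
    which makes second differences with step proportional to phi of constant
    size. *)
Definition entropy t := xlnx t + xlnx (1 - t).

Lemma continuous_entropy : continuous entropy.
Proof.
move=> t; apply: cvgD; first exact: continuous_xlnx.
have c1 : {for t, continuous (fun u : R => 1 - u)}.
  by apply: cvgB; [exact: cvg_cst|exact: cvg_id].
exact: (continuous_comp c1 (@continuous_xlnx _)).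
Qed.

Lemma entropy_second_diff x s : 0 < x < 1 -> 0 <= x - s <= 1 -> 0 <= x + s <= 1 ->
  s ^+ 2 / (x * (1 - x)) / 2 <= entropy (x + s) + entropy (x - s) - 2 * entropy x.
Proof.
move=> /andP[x0 x1] /andP[a0 a1] /andP[b0 b1].
have h1 := xlnx_second_diff x0 a0 b0.
have := @xlnx_second_diff (1 - x) s; rewrite !subr_gt0 => /(_ x1).
have -> : 1 - x - s = 1 - (x + s) by ring.
have -> : 1 - x + s = 1 - (x - s) by ring.
rewrite !subr_ge0 => /(_ b1 a1) h2.
have -> : s ^+ 2 / (x * (1 - x)) / 2 = s ^+ 2 / x / 2 + s ^+ 2 / (1 - x) / 2.
  by field; lra.
by rewrite /entropy; lra.
Qed.

(** The quadratic majorants of xlnx at x and at 1 - x touch it there, so only the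
    variance x (1 - x) / m contributes, divided by x and by 1 - x. *)
Lemma bern_entropy m x : (0 < m)%N -> 0 < x < 1 ->
  bern m (fun k => entropy (k%:R / m%:R)) x <= entropy x + m%:R^-1.
Proof.
move=> m0 /andP[x0 x1].
have mR : m%:R != 0 :> R by rewrite pnatr_eq0 -lt0n.
pose A := 1 / x + 1 / (1 - x).
pose B := ln x - ln (1 - x) - 2 / (1 - x).
pose C := ln (1 - x) - 1 + 1 / (1 - x).
apply: (@le_trans _ _ (bern m (fun k => A * (k%:R / m%:R) ^+ 2
   + 1 * (B * (k%:R / m%:R) + C * 1)) x)).
  apply: le_bern => [|k km]; first lra.
  set t := k%:R / m%:R.
  have t0 : 0 <= t by rewrite divr_ge0.
  have t1 : t <= 1 by rewrite ler_pdivrMr ?ltr0n// mul1r ler_nat.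
  have := xlnx_le_quadratic x0 t0.
  have := @xlnx_le_quadratic (1 - x) (1 - t).
  rewrite !subr_gt0 subr_ge0 => /(_ x1 t1).
  rewrite /entropy /A /B /C; lra.
rewrite !bern_lin bern_cst bern_node// bern_node_sqr//.
rewrite le_eqVlt; apply/orP; left; apply/eqP.
by rewrite /A /B /C /entropy /xlnx; field; lra.
Qed.
End entropy.

(** * The direct estimate for Bernstein operators *)

Section direct_estimate.
Context {R : realType}.
Implicit Types (f F : R -> R) (W a b x y s t : R) (n m k : nat).

(** Convexity at x up to an additive error W, cleared of denominators. *)
Definition near_convex_at W F x := forall a b, 0 <= a -> a < x -> x < b -> b <= 1 ->
  (b - a) * F x <= (b - x) * F a + (x - a) * F b + (b - a) * W.

Lemma I01E x : I01 x = (0 <= x <= 1) :> Prop.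
Proof. by rewrite /I01 /= in_itv. Qed.

(** The slope is the supremum of the slopes of the lines from the points (a, F a),
    a < x, to (x, F x - W); near-convexity says that each of these is at most
    each slope towards a point b > x. *)
Lemma near_convex_support W F x : 0 <= W -> 0 < x < 1 -> near_convex_at W F x ->
  exists s, forall t, 0 <= t <= 1 -> F x - W + s * (t - x) <= F t.
Proof.
move=> W0 /andP[x0 x1] nc.
pose S := [set (F x - W - F a) / (x - a) | a in [set a | 0 <= a < x]].
have S_ub b : x < b -> b <= 1 -> ubound S ((F b - (F x - W)) / (b - x)).
  move=> xb b1 _ [a /= /andP[a0 ax] <-].
  rewrite ler_pdivrMr ?subr_gt0// mulrAC ler_pdivlMr ?subr_gt0//.
  by have := nc a b a0 ax xb b1; lra.
have S0 : S !=set0 by exists ((F x - W - F 0) / (x - 0)); exists 0 => //=; lra.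
exists (sup S) => t /andP[t0 t1].
have [tx|xt|->] := ltrgtP t x; last by lra.
- have : (F x - W - F t) / (x - t) <= sup S.
    apply: ub_le_sup; last by exists t => //=; lra.
    by exists ((F 1 - (F x - W)) / (1 - x)); exact: S_ub.
  by rewrite ler_pdivrMr ?subr_gt0//; lra.
- have : sup S <= (F t - (F x - W)) / (t - x).
    by apply: ge_sup => //; exact: S_ub.
  by rewrite ler_pdivlMr ?subr_gt0//; lra.
Qed.

Lemma node01 k m : (0 < m)%N -> (k <= m)%N -> 0 <= (k%:R / m%:R : R) <= 1.
Proof.
move=> m0 km; rewrite divr_ge0//=.
by rewrite ler_pdivrMr ?ltr0n// mul1r ler_nat.
Qed.

Lemma near_convex_jensen W F x m : (0 < m)%N -> 0 <= W -> 0 < x < 1 ->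
  near_convex_at W F x -> F x - W <= bern m (fun k => F (k%:R / m%:R)) x.
Proof.
move=> m0 W0 x01 /(near_convex_support W0 x01)[s Fs].
have := @le_bern _ m (fun k => s * (k%:R / m%:R) + (F x - W - s * x) * 1)
  (fun k => F (k%:R / m%:R)) x.
rewrite bern_lin bern_node// bern_cst => le_s.
apply: le_trans (le_s _ _); [lra|lra|move=> k km].
by apply: le_trans (Fs _ (node01 m0 km)); lra.
Qed.

(** The condition on s says that s <= phi(y) / sqrt n. *)
Definition second_diff_ge n W f := forall y s, 0 <= s -> 0 <= y - s -> y + s <= 1 ->
  n%:R * s ^+ 2 <= y * (1 - y) -> - W <= f (y + s) + f (y - s) - 2 * f y.

(** The maximum principle behind near-convexity: at a maximum point y the second
    difference is nonpositive, and it is even at most - E y when the step ends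
    at a point where E vanishes.  Either the full step phi(y) / sqrt n fits into
    [a, b], which the hypothesis with W > 0 excludes, or the distance to the
    nearer endpoint is an admissible step. *)
Lemma second_diff_max n W E a b y : (0 < n)%N -> 0 < W ->
  0 <= a -> b <= 1 -> a <= y <= b -> E a = 0 -> E b = 0 ->
  (forall t, a <= t <= b -> E t <= E y) ->
  (forall s, 0 < y < 1 -> 0 <= s -> 0 <= y - s -> y + s <= 1 ->
    n%:R * s ^+ 2 <= y * (1 - y) ->
    2 * W * (n%:R * s ^+ 2 / (y * (1 - y))) - W <= E (y + s) + E (y - s) - 2 * E y) ->
  E y <= W.
Proof.
move=> n0 W0 a0 b1 /andP[ay yb] Ea Eb Emax second_diff.
have nR : 0 < n%:R :> R by rewrite ltr0n.
have [ya|ya] := eqVneq y a; first by rewrite ya Ea ltW.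
have [yb'|yb'] := eqVneq y b; first by rewrite yb' Eb ltW.
have {ya}ay : a < y by rewrite lt_neqAle eq_sym ya.
have {yb'}yb : y < b by rewrite lt_neqAle yb'.
have y01 : 0 < y < 1 by rewrite (le_lt_trans a0 ay) (lt_le_trans yb b1).
have v0 : 0 < y * (1 - y) by case/andP: y01 => *; rewrite mulr_gt0 ?subr_gt0.
set sg := Num.sqrt (y * (1 - y) / n%:R).
have sg0 : 0 <= sg by exact: sqrtr_ge0.
have sg2 : n%:R * sg ^+ 2 = y * (1 - y).
  by rewrite sqr_sqrtr ?divr_ge0 ?ltW// mulrC divfK ?gt_eqF.
clearbody sg.
have le_sg s : 0 <= s -> s <= sg -> n%:R * s ^+ 2 <= y * (1 - y).
  by move=> s0 ss; rewrite -sg2 ler_pM2l// ler_pXn2r// nnegrE.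
have step_end s : 0 <= s -> s <= sg -> a <= y - s -> y + s <= b ->
    E (y - s) = 0 \/ E (y + s) = 0 -> E y <= W.
  move=> s0 ssg yas ybs Es.
  have := second_diff s y01 s0 (le_trans a0 yas) (le_trans ybs b1) (le_sg s s0 ssg).
  have : 0 <= 2 * W * (n%:R * s ^+ 2 / (y * (1 - y))).
    by rewrite mulr_ge0 ?divr_ge0 ?(ltW v0)// mulr_ge0 ?sqr_ge0 ?(ltW W0).
  have h1 : E (y - s) <= E y by apply: Emax; rewrite yas /=; clear -s0 yb; lra.
  have h2 : E (y + s) <= E y by apply: Emax; rewrite ybs andbT; clear -s0 ay; lra.
  by case: Es => Es; rewrite Es in h1 h2 *; clear -h1 h2; lra.
have [le_ab|lt_ba] := leP (y - a) (b - y).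
  have [lt_sga|le_sga] := leP (y - a) sg.
    by apply: (step_end (y - a)); [lra|lra|lra|lra|left; rewrite subKr].
  have := second_diff sg y01 sg0 ltac:(lra) ltac:(lra) (le_sg _ sg0 (lexx _)).
  rewrite sg2 divff ?gt_eqF//.
  have := Emax (y - sg) ltac:(lra); have := Emax (y + sg) ltac:(lra).
  by clear -W0; lra.
have [lt_sgb|le_sgb] := leP (b - y) sg.
  by apply: (step_end (b - y)); [lra|lra|lra|lra|right; rewrite subrKC].
have := second_diff sg y01 sg0 ltac:(lra) ltac:(lra) (le_sg _ sg0 (lexx _)).
rewrite sg2 divff ?gt_eqF//.
have := Emax (y - sg) ltac:(lra); have := Emax (y + sg) ltac:(lra).
by clear -W0; lra.
Qed.

(** The factor 4 n W makes the second differences of the entropy term with full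
    step at least 2 W, twice what f can contribute negatively. *)
Lemma entropy_near_convex n W f x : (0 < n)%N -> 0 < W ->
  {within I01, continuous f} -> second_diff_ge n W f ->
  near_convex_at W (fun t => f t + 4 * n%:R * W * entropy t) x.
Proof.
move=> n0 W0 cf fW; set F := (X in near_convex_at _ X) => a b a0 ax xb b1.
have nR : 0 < n%:R :> R by rewrite ltr0n.
pose E t := F t - (F a * (b - t) + F b * (t - a)) / (b - a).
have ba : b - a != 0 by lra.
have Ea : E a = 0 by rewrite /E; field.
have Eb : E b = 0 by rewrite /E; field.
have cE : {within `[a, b], continuous E}.
  have sub : `[a, b] `<=` (@I01 R).
    by move=> t /=; rewrite in_itv I01E /= => ?; lra.
  have cont_aff : continuous (fun t => (F a * (b - t) + F b * (t - a)) / (b - a)).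
    move=> t; apply: cvgMr_tmp; apply: cvgD; apply: cvgMl_tmp; apply: cvgB;
      by [exact: cvg_cst|exact: cvg_id].
  have cent : continuous (fun t => 4 * n%:R * W * entropy t).
    by move=> t; apply: cvgMl_tmp; exact: continuous_entropy.
  move=> t; apply: cvgB; last exact: (continuous_subspaceT cont_aff).
  apply: cvgD; last exact: (continuous_subspaceT cent).
  exact: (continuous_subspaceW sub cf).
have [y] := EVT_max (ltW (lt_trans ax xb)) cE.
rewrite in_itv /= => /andP[ay yb] Emax.
have second_diff s : 0 < y < 1 -> 0 <= s -> 0 <= y - s -> y + s <= 1 ->
    n%:R * s ^+ 2 <= y * (1 - y) ->
    2 * W * (n%:R * s ^+ 2 / (y * (1 - y))) - W <= E (y + s) + E (y - s) - 2 * E y.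
  move=> y01 s0 ys0 ys1 sy.
  have h1 := fW _ _ s0 ys0 ys1 sy.
  have h2 : s ^+ 2 / (y * (1 - y)) / 2 <=
      entropy (y + s) + entropy (y - s) - 2 * entropy y.
    by apply: entropy_second_diff => //; lra.
  have {}h2 : 0 <= 4 * n%:R * W * (entropy (y + s) + entropy (y - s) - 2 * entropy y
      - s ^+ 2 / (y * (1 - y)) / 2) by rewrite mulr_ge0 ?subr_ge0 ?mulr_ge0// ltW.
  have -> : E (y + s) + E (y - s) - 2 * E y = F (y + s) + F (y - s) - 2 * F y.
    by rewrite /E; field.
  by rewrite /F; lra.
have EyW : E y <= W.
  apply: (second_diff_max n0 W0 a0 b1 _ Ea Eb _ second_diff); first by rewrite ay yb.
  by move=> t abt; apply: Emax; rewrite in_itv.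
have : E x <= W.
  by apply: le_trans EyW; apply: Emax; rewrite in_itv /=; lra.
rewrite /E -(ler_pM2r (_ : 0 < b - a)); last by lra.
by rewrite mulrBl divfK//; lra.
Qed.

Lemma bern_ge n m W f x : (0 < n)%N -> (n <= m.*2)%N -> 0 < W -> 0 < x < 1 ->
  {within I01, continuous f} -> second_diff_ge n W f ->
  f x - 9 * W <= bern m (fun k => f (k%:R / m%:R)) x.
Proof.
move=> n0 nm W0 x01 cf fW.
have m0 : (0 < m)%N by rewrite -double_gt0 (leq_trans n0).
have := near_convex_jensen m0 (ltW W0) x01 (entropy_near_convex n0 W0 cf fW).
rewrite (_ : (fun k => _) = fun k => 1 * f (k%:R / m%:R)
   + 4 * n%:R * W * entropy (k%:R / m%:R)); last by apply/funext => k; rewrite mul1r.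
rewrite bern_lin.
have nW : 0 <= 4 * n%:R * W by rewrite !mulr_ge0 ?(ltW W0).
have := ler_wpM2l nW (bern_entropy m0 x01).
have : 4 * n%:R * W * m%:R^-1 <= 8 * W.
  rewrite ler_pdivrMr ?ltr0n//.
  have : n%:R <= 2 * m%:R :> R by rewrite -natrM ler_nat mul2n.
  by move=> /(ler_wpM2l (_ : 0 <= 4 * W)) h; have := h ltac:(lra); lra.
by lra.
Qed.

Lemma bern0 m (c : nat -> R) : bern m c 0 = c 0%N.
Proof. by elim: m c => [//|m IH] c; rewrite bernS IH subr0; ring. Qed.

Lemma bern1 m (c : nat -> R) : bern m c 1 = c m.
Proof. by elim: m c => [//|m IH] c; rewrite bernS !IH subrr /=; ring. Qed.

(** The two one-sided bounds need a positive W, hence the small e. *)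
Lemma bern_approx n m W f x : (0 < n)%N -> (n <= m.*2)%N -> 0 <= W -> 0 <= x <= 1 ->
  {within I01, continuous f} ->
  (forall y s, 0 <= s -> 0 <= y - s -> y + s <= 1 ->
    n%:R * s ^+ 2 <= y * (1 - y) -> `|f (y + s) + f (y - s) - 2 * f y| <= W) ->
  `|f x - bern m (fun k => f (k%:R / m%:R)) x| <= 9 * W.
Proof.
move=> n0 nm W0 /andP[x0 x1] cf fW.
have m0 : (0 < m)%N by rewrite -double_gt0 (leq_trans n0).
have mR : m%:R != 0 :> R by rewrite pnatr_eq0 -lt0n.
have [->|xn0] := eqVneq x 0.
  by rewrite bern0 mul0r subrr normr0 mulr_ge0.
have [->|xn1] := eqVneq x 1.
  by rewrite bern1 divff// subrr normr0 mulr_ge0.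
have x01 : 0 < x < 1 by rewrite !lt_neqAle xn1 eq_sym xn0 x0.
apply/ler_addgt0Pr => e e0.
pose W' := W + e / 9.
have W'0 : 0 < W' by rewrite /W'; lra.
have h1 : second_diff_ge n W' f.
  move=> y s s0 ys0 ys1 sy; have := fW y s s0 ys0 ys1 sy.
  by rewrite ler_norml /W' => /andP[]; lra.
have h2 : second_diff_ge n W' (- f).
  move=> y s s0 ys0 ys1 sy; have := fW y s s0 ys0 ys1 sy.
  by rewrite ler_norml /W' !fctE => /andP[]; lra.
have cNf : {within I01, continuous (- f)} by move=> t; apply: cvgN; exact: cf.
have := bern_ge n0 nm W'0 x01 cf h1.
have := bern_ge n0 nm W'0 x01 cNf h2.
rewrite (_ : (fun k => _) = fun k => (-1) * f (k%:R / m%:R) + 0 * 1); last first.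
  by apply/funext => k; rewrite !fctE; ring.
rewrite bern_lin !fctE /W' ler_norml.
by move=> ? ?; apply/andP; split; lra.
Qed.
End direct_estimate.

(** * Iterated differences and derivatives *)

Section differences.
Context {R : realType}.
Implicit Types (f g : R -> R) (u v : nat -> R -> R) (a b h x : R) (r k n m : nat).

Definition fwd_diff h f : R -> R := fun x => f (x + h) - f x.

Lemma iter_fwd_diffE r h f x : iter r (fwd_diff h) f x =
  \sum_(k < r.+1) (-1) ^+ k * 'C(r, k)%:R * f (x + (r%:R - k%:R) * h).
Proof.
transitivity (casteljau 1 (-1) r (fun k => f (x + (r%:R - k%:R) * h))).
  elim: r f x => [|r IH] f x; first by rewrite /= subrr mul0r addr0.
  rewrite iterS /fwd_diff !IH /= mul1r mulN1r; congr (_ - _); apply: eq_casteljau => k _;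
    by congr f; rewrite /= -!natr1; ring.
rewrite casteljauE; apply: eq_bigr => k _.
by rewrite expr1n mulr1; ring.
Qed.

Lemma norm_iter_fwd_diff_le r h f x (K : R) : 0 <= h ->
  (forall y, x <= y <= x + r%:R * h -> `|f y| <= K) ->
  `|iter r (fwd_diff h) f x| <= 2 ^+ r * K.
Proof.
move=> h0; elim: r x => [|r IH] x fK.
  by rewrite mul1r /=; apply: fK; rewrite mul0r addr0 lexx.
rewrite iterS /fwd_diff (le_trans (ler_normB _ _))// exprS -mulrA mulr_natl mulr2n.
have rh : 0 <= r%:R * h by rewrite mulr_ge0.
by apply: lerD; apply: IH => y yx; apply: fK; rewrite -natr1; lra.
Qed.

(** The successive derivatives are carried as a sequence u of functions, so that
    one mean value theorem applies both to f, whose derivatives are limits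
    relative to [0, 1], and to Bernstein polynomials; continuity on the closed
    interval is all that is asked at the endpoints. *)
Definition deriv_chain r a b u := forall k, (k < r)%N ->
  (forall x, a < x < b -> is_derive x 1 (u k) (u k.+1 x)) /\
  {within `[a, b], continuous (u k)}.

Lemma deriv_chainB r a b u v : deriv_chain r a b u -> deriv_chain r a b v ->
  deriv_chain r a b (fun k => u k - v k).
Proof.
move=> du dv k kr; have [duk cu] := du k kr; have [dvk cv] := dv k kr; split.
  by move=> x x01; apply: is_deriveB; [exact: duk|exact: dvk].
by move=> x; apply: cvgB; [exact: cu|exact: cv].
Qed.

Lemma deriv_chainS r a b a' b' u : a <= a' -> b' <= b ->
  deriv_chain r a b u -> deriv_chain r a' b' u.
Proof.
move=> aa bb du k kr; have [duk cu] := du k kr; split.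
  by move=> x x01; apply: duk; lra.
apply: continuous_subspaceW cu => x /=; rewrite !in_itv /=; lra.
Qed.

Lemma deriv_chain_fwd_diff r a b h u : 0 <= h -> deriv_chain r a b u ->
  deriv_chain r a (b - h) (fun k => fwd_diff h (u k)).
Proof.
move=> h0 du k kr; have [duk cu] := du k kr; split.
  move=> x x01; apply: is_deriveB; last by apply: duk; lra.
  have d1 : is_derive (x + h) 1 (u k) (u k.+1 (x + h)) by apply: duk; lra.
  have d2 : is_derive x 1 (fun y => y + h) 1.
    by rewrite -[X in is_derive _ _ _ X](addr0 1); exact: is_deriveD.
  by have := @is_derive1_comp R (u k) (fun y => y + h) x _ 1 d1 d2; rewrite mulr1.
have sub : `[a, b - h] `<=` `[a, b] by move=> x /=; rewrite !in_itv /=; lra.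
have cuh : {within `[a, b - h], continuous (fun y => u k (y + h))}.
  apply/subspace_continuousP => x xab P uP.
  have xhab : `[a, b]%classic (x + h) by move: xab; rewrite /= !in_itv /=; lra.
  have near_xh : \forall z \near x + h, `[a, b]%classic z -> P (u k z).
    by move/subspace_continuousP : cu => /(_ _ xhab P uP).
  have shift : y + h @[y --> x] --> x + h by apply: cvgD; [exact: cvg_id|exact: cvg_cst].
  change (\forall y \near x, `[a, b - h]%classic y -> P (u k (y + h))).
  have : \forall y \near x, `[a, b]%classic (y + h) -> P (u k (y + h)) := shift _ near_xh.
  apply: filterS => y /= Py yab; apply: Py.
  by move: yab; rewrite !in_itv /=; lra.
by move=> x; apply: cvgB; [exact: cuh|exact: (continuous_subspaceW sub cu)].
Qed.

Lemma fwd_diff_MVT a h u : 0 < h -> deriv_chain 1 a (a + h) u ->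
  exists2 xi, a < xi < a + h & fwd_diff h (u 0%N) a = h * u 1%N xi.
Proof.
move=> h0 /(_ 0%N isT)[du cu].
have ah : a < a + h by rewrite ltrDl.
have du' x : x \in `]a, a + h[ -> is_derive x 1 (u 0%N) (u 1%N x).
  by rewrite in_itv; exact: du.
have [xi] := MVT ah du' cu.
by rewrite in_itv => xiah E; exists xi => //; rewrite /fwd_diff E; ring.
Qed.

(** By induction on the order: forward differences of a chain form a chain on the
    interval shortened by h, and the last difference is again a first-order
    one. *)
Lemma deriv_chain_MVT r a h u : 0 < h -> deriv_chain r.+1 a (a + r.+1%:R * h) u ->
  exists2 xi, a < xi < a + r.+1%:R * h &
    iter r.+1 (fwd_diff h) (u 0%N) a = h ^+ r.+1 * u r.+1 xi.
Proof.
move=> h0; elim: r u => [|r IH] u du.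
  by move: du; rewrite mul1r => /(fwd_diff_MVT h0).
have du' : deriv_chain r.+1 a (a + r.+1%:R * h) (fun k => fwd_diff h (u k)).
  have -> : a + r.+1%:R * h = a + r.+2%:R * h - h by rewrite -[r.+2%:R]natr1; ring.
  by apply: deriv_chain_fwd_diff (ltW h0) _ => k kr; apply: du; exact: leqW.
have [xi xi_in E] := IH _ du'.
have dlast : deriv_chain 1 xi (xi + h) (fun k => u (r.+1 + k)%N).
  move=> [|//] _; rewrite addn0 addn1.
  have := @deriv_chainS r.+2 a (a + r.+2%:R * h) xi (xi + h) u.
  apply => //; [lra|].
  by rewrite -[r.+2%:R]natr1; lra.
have [eta eta_in E'] := fwd_diff_MVT h0 dlast.
exists eta; first by rewrite -[r.+2%:R]natr1; lra.
by rewrite iterSr E; move: E'; rewrite addn0 addn1 => ->; rewrite [h ^+ r.+2]exprSr mulrA.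
Qed.

(** The punctured relative limit in a form that can be restricted to interior
    points or combined with the value at x itself. *)
Lemma derivableI_cvg f x : derivableI f x ->
  forall e, 0 < e -> \forall y \near x, I01 y -> y != x ->
    `|derivI f x - (f y - f x) / (y - x)| < e.
Proof.
move=> /cvgrPdist_lt cf e e0; move: (cf e e0).
by rewrite !near_withinE; apply: filterS => y h Iy /h; exact.
Qed.

Lemma derivableI_is_derive f x : 0 < x < 1 -> derivableI f x ->
  is_derive x 1 f (derivI f x).
Proof.
move=> /andP[x0 x1] /derivableI_cvg cf.
have Ix : \forall y \near x, I01 y.
  near=> y; rewrite I01E; apply/andP.
  by split; apply: ltW; near: y; [exact: lt_nbhsr|exact: lt_nbhsl].
have lim1 : h^-1 *: (f (h *: 1 + x) - f x) @[h --> 0^'] --> derivI f x.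
  apply/cvgrPdist_lt => e e0; have /nbhs0P cf0 := cf e e0; move/nbhs0P : Ix => Ix0.
  rewrite near_withinE; near=> h => h0.
  have -> : h *: 1 + x = x + h by rewrite addrC /GRing.scale /= mulr1.
  have Ih : I01 (x + h) by near: h.
  have : I01 (x + h) -> x + h != x ->
    `|derivI f x - (f (x + h) - f x) / (x + h - x)| < e by near: h.
  rewrite -subr_eq0 [x + h]addrC addrK /GRing.scale /= [h^-1 * _]mulrC.
  by apply; rewrite // addrC.
apply: DeriveDef; first by apply/cvg_ex; exists (derivI f x).
exact: cvg_lim.
Unshelve. all: by end_near. Qed.

Lemma derivableI_continuous f : (forall x, I01 x -> derivableI f x) ->
  {within I01, continuous f}.
Proof.
move=> df; apply/subspace_continuousP => x /df /derivableI_cvg cf.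
apply/cvgrPdist_lt => e e0; rewrite near_withinE.
pose M := `|derivI f x| + 1; have M0 : 0 < M by rewrite ltr_wpDl.
have cf1 := cf 1 ltr01.
near=> y => Iy; have [->|yx] := eqVneq y x; first by rewrite subrr normr0.
have : `|derivI f x - (f y - f x) / (y - x)| < 1.
  by move: Iy yx; near: y.
have yx0 : y - x != 0 by rewrite subr_eq0.
set q := (f y - f x) / (y - x) => qd.
have qM : `|q| < M.
  have -> : q = derivI f x - (derivI f x - q) by ring.
  by rewrite (le_lt_trans (ler_normB _ _))// /M ltrD2l.
have -> : f x - f y = q * (x - y) by rewrite /q; field.
have : M * `|x - y| < e; last first.
  by rewrite normrM; apply: le_lt_trans; rewrite ler_wpM2r// ltW.
rewrite mulrC -ltr_pdivlMr//.
near: y; apply: cvgr_dist_lt; first exact: cvg_id.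
by rewrite divr_gt0.
Unshelve. all: by end_near. Qed.

Lemma CI_deriv_chain r f : CI r f -> deriv_chain r 0 1 (fun k => derivIn k f).
Proof.
move=> [df cf] k kr; split.
  move=> x x01; rewrite [derivIn k.+1 f]iterS.
  by apply: derivableI_is_derive => //; apply: df => //; rewrite I01E; lra.
exact: derivableI_continuous (df k kr).
Qed.

Lemma continuous_bern m (c : nat -> R) : continuous (bern m c).
Proof.
move=> x; apply/differentiable_continuous/derivable1_diffP.
exact: (@ex_derive _ _ _ _ _ _ _ (is_derive_bern m c x)).
Qed.

Definition bern_derivn n (c : nat -> R) j x := (n ^_ j)%:R * bern (n - j) (iter j diffs c) x.

Lemma bern_deriv_chain n r (c : nat -> R) a b : deriv_chain r a b (bern_derivn n c).
Proof.
move=> k _; split.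
  move=> x _; have d := is_derive_bern (n - k) (iter k diffs c) x.
  rewrite /bern_derivn ffactnSr subnS natrM -mulrA.
  exact: is_deriveZ.
by apply: continuous_subspaceT => x; apply: cvgMl_tmp; exact: continuous_bern.
Qed.

Lemma iter_diffs_node r h f k :
  iter r diffs (fun j => f (j%:R * h)) k = iter r (fwd_diff h) f (k%:R * h).
Proof.
elim: r k => [//|r IH] k; rewrite !iterS /diffs /fwd_diff !IH.
by rewrite -natr1 mulrDl mul1r.
Qed.
End differences.

(** * Moduli of smoothness as real numbers *)

Section moduli.
Context {R : realType}.
Implicit Types (f F : R -> R) (x y s h d K : R) (n : nat).

(** For a bounded function all the suprema of the statement are nonnegative real
    numbers, so the estimates can be carried out in R. *)
Lemma ereal_sup_fin (S : set (\bar R)) K : (exists2 e, S e & 0 <= e)%E ->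
  (forall e, S e -> e <= K%:E)%E -> exists2 w, 0 <= w & ereal_sup S = w%:E.
Proof.
move=> [e Se e0] SK.
have supK : (ereal_sup S <= K%:E)%E by exact: ge_ereal_sup.
have sup0 : (0 <= ereal_sup S)%E by apply: le_trans e0 _; exact: ereal_sup_ubound.
have supfin : ereal_sup S \is a fin_num.
  by rewrite ge0_fin_numE// (le_lt_trans supK)// ltry.
by exists (fine (ereal_sup S)); rewrite ?fineK// fine_ge0.
Qed.

Lemma continuous_bounded01 f : {within I01, continuous f} ->
  exists K, forall x, I01 x -> `|f x| <= K.
Proof.
move=> cf.
have cNf : {within `[0, 1], continuous (fun x => `|f x|)}.
  by move=> x; apply: cvg_norm; exact: cf.
have [a _ fa] := EVT_max ler01 cNf.
by exists `|f a| => x; rewrite I01E => ?; apply: fa; rewrite in_itv.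
Qed.

Lemma normI_le f K : (normI f <= K%:E)%E <-> forall x, I01 x -> `|f x| <= K.
Proof.
split=> [fK x Ix|fK].
  by rewrite -lee_fin; apply: le_trans fK; apply: ereal_sup_ubound; exists x.
by apply: ge_ereal_sup => _ [x Ix <-]; rewrite lee_fin fK.
Qed.

Lemma normI_fin f K : (forall x, I01 x -> `|f x| <= K) ->
  exists2 w, 0 <= w & normI f = w%:E.
Proof.
move=> fK; apply: (@ereal_sup_fin _ K).
  by exists (`|f 0|%:E); [exists 0; rewrite // I01E lexx ler01|rewrite lee_fin].
by move=> _ [x Ix <-]; rewrite lee_fin fK.
Qed.

Lemma omega1_fin f d K : 0 < d -> (forall x, I01 x -> `|f x| <= K) ->
  exists2 w, 0 <= w & omega1 f d = w%:E.
Proof.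
move=> d0 fK; apply: (@ereal_sup_fin _ (2 * K)).
  have I0 : @I01 R 0 by rewrite I01E lexx ler01.
  by exists 0%E => //; exists 0, 0; split; rewrite // !subrr normr0.
move=> _ [x [y [Ix Iy _ ->]]]; rewrite lee_fin.
rewrite (le_trans (ler_normB _ _))//.
by have := fK x Ix; have := fK y Iy; lra.
Qed.

Lemma omega1_ge f d w x y : omega1 f d = w%:E -> I01 x -> I01 y -> `|x - y| < d ->
  `|f x - f y| <= w.
Proof.
move=> wE Ix Iy xy; rewrite -lee_fin -wE.
by apply: ereal_sup_ubound; exists x, y.
Qed.

Lemma symdiff2E h psi f x : let s := h * psi x in symdiff 2 h psi f x =
  if (x + s \in `[0, 1]) && (x - s \in `[0, 1])
  then f (x + s) + f (x - s) - 2 * f x else 0.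
Proof.
move=> s; rewrite /symdiff -/s divff// mul1r; case: ifP => // _.
rewrite !big_ord_recl big_ord0 /= /bump /=.
rewrite (_ : x + (1 - 0) * s = x + s); last by ring.
rewrite (_ : x + (1 - 1) * s = x); last by ring.
rewrite (_ : x + (1 - 2) * s = x - s); last by ring.
rewrite bin0 binn (_ : 'C(2, 1)%N = 2%N)//; ring.
Qed.

Lemma omega2_phi_fin f d K : 0 <= d -> (forall x, I01 x -> `|f x| <= K) ->
  exists2 w, 0 <= w & omega2_phi f d = w%:E.
Proof.
move=> d0 fK; apply: (@ereal_sup_fin _ (4 * K)).
  exists (normI (symdiff 2 0 phi f)); first by exists 0; rewrite //= normr0.
  apply: le_trans (ereal_sup_ubound _); last first.
    by exists 0; rewrite // I01E lexx ler01.
  by rewrite lee_fin.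
move=> _ [h _ <-]; apply/normI_le => x Ix; rewrite symdiff2E /=.
have K0 : 0 <= K by apply: le_trans (fK x Ix).
case: ifP => [|_]; last by rewrite normr0; lra.
move=> /andP[/fK h1 /fK h2].
rewrite (le_trans (ler_normB _ _))// (le_trans (lerD (ler_normD _ _) (lexx _)))//.
by rewrite normrM ger0_norm//; have := fK x Ix; lra.
Qed.

(** An admissible step s is h phi(y) with h = s / phi(y); at the endpoints
    phi(y) = 0 forces s = 0. *)
Lemma omega2_phi_ge f n w y s : (0 < n)%N -> omega2_phi f (1 / Num.sqrt n%:R) = w%:E ->
  0 <= s -> 0 <= y - s -> y + s <= 1 -> n%:R * s ^+ 2 <= y * (1 - y) ->
  `|f (y + s) + f (y - s) - 2 * f y| <= w.
Proof.
move=> n0 wE s0 ys0 ys1 sy.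
have nR : 0 < n%:R :> R by rewrite ltr0n.
have sphi : Num.sqrt n%:R * s <= phi y.
  rewrite -(@ler_pXn2r _ 2) ?nnegrE ?mulr_ge0 ?sqrtr_ge0//.
  by rewrite exprMn sqr_sqrtr ?(ltW nR)// sqr_sqrtr// mulr_ge0//; lra.
have [h hd hs] : exists2 h, `|h| <= 1 / Num.sqrt n%:R & h * phi y = s.
  have phi0 : 0 <= phi y by exact: sqrtr_ge0.
  have sn0 : 0 < Num.sqrt (n%:R : R) by rewrite sqrtr_gt0.
  have [p0|p0] := eqVneq (phi y) 0.
    exists 0; first by rewrite normr0 divr_ge0// ltW.
    rewrite mul0r; apply/eqP; rewrite eq_le s0 /= -(ler_pM2l sn0) mulr0.
    by rewrite -p0.
  exists (s / phi y); last by rewrite divfK.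
  have {}phi0 : 0 < phi y by rewrite lt_neqAle eq_sym p0.
  rewrite ger0_norm; last by rewrite divr_ge0// ltW.
  rewrite ler_pdivrMr// mulrAC ler_pdivlMr// mul1r.
  by rewrite mulrC.
have : (`|symdiff 2 h phi f y|%:E <= w%:E)%E.
  rewrite -wE; apply: (@le_trans _ _ (normI (symdiff 2 h phi f))).
    by apply: ereal_sup_ubound; exists y => //; rewrite I01E; lra.
  by apply: ereal_sup_ubound; exists h.
rewrite lee_fin symdiff2E /= hs !in_itv /= ifT//.
by apply/andP; split; lra.
Qed.
End moduli.

(** * Derivatives of Bernstein polynomials *)

Section bernstein_derivative.
Context {R : realType}.
Implicit Types (f F : R -> R) (n r : nat).

(** The ratio is the product of the 1 - j / n for j < r, and
    0 + 1 + ... + (r - 1) = r (r - 1) / 2. *)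
Lemma ffact_ratio n r : (r <= n)%N ->
  1 - r%:R * (r%:R - 1) / 2 / n%:R <= (n ^_ r)%:R / n%:R ^+ r :> R /\
  (n ^_ r)%:R / n%:R ^+ r <= 1 :> R.
Proof.
elim: r => [|r IH] rn; first by rewrite ffactn0 !mul0r subr0 expr0 divr1 lexx.
have n0 : 0 < n%:R :> R by rewrite ltr0n (leq_ltn_trans _ rn).
have [q0 q1] := IH (ltnW rn).
have qq0 : 0 <= (n ^_ r)%:R / n%:R ^+ r :> R by rewrite divr_ge0 ?exprn_ge0.
have -> : (n ^_ r.+1)%:R / n%:R ^+ r.+1
    = (n ^_ r)%:R / n%:R ^+ r * (1 - r%:R / n%:R) :> R.
  rewrite ffactnSr natrM natrB 1?ltnW// exprS.
  by field; rewrite ?expf_neq0 ?gt_eqF.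
set q := _ / _ ^+ r in q0 q1 qq0 *; set t := _ / _.
have t0 : 0 <= t by rewrite divr_ge0.
have t1 : t <= 1 by rewrite ler_pdivrMr// mul1r ler_nat ltnW.
have -> : r.+1%:R * (r.+1%:R - 1) / 2 / n%:R = r%:R * (r%:R - 1) / 2 / n%:R + t.
  by rewrite /t -natr1; field; rewrite gt_eqF.
clearbody q t; have := mulr_ge0 qq0 t0.
have : 0 <= (1 - q) * t by rewrite mulr_ge0 ?subr_ge0.
by clear -q0 q1; split; lra.
Qed.

Lemma one_sub_ffact_ratio n r : (0 < r)%N -> (r <= n)%N ->
  0 <= 1 - (n ^_ r)%:R / n%:R ^+ r :> R /\
  1 - (n ^_ r)%:R / n%:R ^+ r <= (r%:R - 1) ^+ 2 / n%:R :> R.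
Proof.
move=> r0 rn; have [] := ffact_ratio rn.
have n0 : 0 < n%:R :> R by rewrite ltr0n (leq_trans r0).
have : r%:R * (r%:R - 1) / 2 / n%:R <= (r%:R - 1) ^+ 2 / n%:R :> R.
  rewrite ler_pM2r ?invr_gt0//.
  case: r r0 {rn} => [//|[|r]] _; first by rewrite subrr mulr0 mul0r sqr_ge0.
  by rewrite -[r.+2%:R]natr1 -[r.+1%:R]natr1; have r0 := ler0n R r; have := mulr_ge0 r0 r0; lra.
by move=> h1 h2 h3; split; clear -h1 h2 h3; lra.
Qed.

(** With q the ratio above and F the r-th derivative, the error splits as
    F - q B(F(xi)) = (F - B(F)) + (B(F) - B(F(xi))) + (1 - q) B(F(xi)),
    where B has degree n - r and the xi are mean value points; each bracket is
    one term of the bound. *)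
Lemma bern_deriv_approx n r f (w1 w2 K x : R) : (0 < r)%N -> (r ^ 2 + 1 <= n)%N ->
  CI r f ->
  (forall y, I01 y -> `|derivIn r f y| <= K) ->
  (forall y z, I01 y -> I01 z -> `|y - z| < r%:R / n%:R ->
    `|derivIn r f y - derivIn r f z| <= w1) ->
  (forall y s, 0 <= s -> 0 <= y - s -> y + s <= 1 -> n%:R * s ^+ 2 <= y * (1 - y) ->
    `|derivIn r f (y + s) + derivIn r f (y - s) - 2 * derivIn r f y| <= w2) ->
  0 <= w2 -> 0 <= x <= 1 ->
  `|derivIn r f x - bern_derivn n (fun k => f (k%:R / n%:R)) r x|
    <= 9 * w2 + w1 + (r%:R - 1) ^+ 2 / n%:R * K.
Proof.
move=> r0 rn Cf FK Fw1 Fw2 w20 x01; have [_ cF] := Cf.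
set F := derivIn r f in FK Fw1 Fw2 cF *.
have {}rn : (r * r + 1 <= n)%N by rewrite mulnn.
have rn' : (r < n)%N by nia.
have nm : (n <= (n - r).*2)%N by nia.
have n0 : (0 < n)%N by lia.
have m0 : (0 < n - r)%N by lia.
have nR : 0 < n%:R :> R by rewrite ltr0n.
have rR : 0 < r%:R :> R by rewrite ltr0n.
have node_mvt k : exists xi, (k <= n - r)%N ->
    [/\ k%:R / n%:R < xi, xi < k%:R / n%:R + r%:R / n%:R, I01 xi &
     iter r diffs (fun k => f (k%:R / n%:R)) k = n%:R^-1 ^+ r * F xi].
  have [kn|kn] := leqP k (n - r); last by exists 0.
  have kr : k%:R / n%:R + r%:R / n%:R <= 1 :> R.
    by rewrite -mulrDl ler_pdivrMr// mul1r -natrD ler_nat; lia.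
  have k0 : 0 <= k%:R / n%:R :> R by rewrite divr_ge0.
  have ch := deriv_chainS k0 kr (CI_deriv_chain Cf).
  rewrite -(prednK r0) in ch.
  have [|xi xi_in E] := deriv_chain_MVT _ ch; first by rewrite invr_gt0.
  exists xi => _; rewrite (prednK r0) in xi_in E; split.
  - by case/andP: xi_in.
  - by case/andP: xi_in.
  - by rewrite I01E; clear -xi_in kr k0; lra.
  - by rewrite iter_diffs_node.
have [xi xiP] := choice node_mvt.
have q_bd := one_sub_ffact_ratio r0 (ltnW rn').
set q := _ / _ ^+ r in q_bd.
have derivnE : bern_derivn n (fun k => f (k%:R / n%:R)) r x = q * bern (n - r) (F \o xi) x.
  have := bern_lin (n - r) (F \o xi) (F \o xi) (n%:R^-1 ^+ r) 0 x.
  rewrite mul0r addr0 => E.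
  rewrite /bern_derivn /q exprVn in E *; rewrite -mulrA -E; congr (_ * _).
  by apply: eq_casteljau => k /xiP[_ _ _ ->]; rewrite mul0r addr0 exprVn.
have FxiK : `|bern (n - r) (F \o xi) x| <= K.
  by apply: ler_norm_bern => // k /xiP[_ _ Ixi _]; exact: FK.
have approx := bern_approx n0 nm w20 x01 cF Fw2.
have shift : `|bern (n - r) (fun k => F (k%:R / (n - r)%:R)) x
    - bern (n - r) (F \o xi) x| <= w1.
  have := bern_lin (n - r) (fun k => F (k%:R / (n - r)%:R)) (F \o xi) 1 (-1) x.
  rewrite mul1r mulN1r => <-; apply: ler_norm_bern => // k kn.
  have [xi1 xi2 Ixi _] := xiP k kn.
  rewrite mul1r mulN1r; apply: Fw1 => //; first by rewrite I01E node01.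
  have mR : 0 < (n - r)%:R :> R by rewrite ltr0n.
  (* k/(n-r) and xi_k lie between k/n and (k+r)/n, and xi_k strictly inside *)
  have nod1 : k%:R / n%:R <= k%:R / (n - r)%:R :> R.
    by rewrite ler_wpM2l// lef_pV2 ?posrE// ler_nat leq_subr.
  have nod2 : k%:R / (n - r)%:R <= k%:R / n%:R + r%:R / n%:R :> R.
    rewrite -mulrDl ler_pdivlMr// mulrAC ler_pdivrMr// -natrD -!natrM ler_nat.
    by clear -kn rn'; nia.
  by rewrite ltr_norml; apply/andP; split; clear -xi1 xi2 nod1 nod2; lra.
rewrite derivnE.
set A := bern _ _ x in approx shift; set B := bern _ _ x in FxiK shift *.
have -> : F x - q * B = (F x - A) + (A - B) + (1 - q) * B by ring.
rewrite (le_trans (ler_normD _ _))// lerD//.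
  by rewrite (le_trans (ler_normD _ _))// lerD.
move: q_bd => [q0 q1].
by rewrite normrM ger0_norm// ler_pM.
Qed.
End bernstein_derivative.

(** * The Hoelder norm *)

Section hoelder.
Context {R : realType}.
Implicit Types (g : R -> R) (a h t A B x : R) (r : nat).

Lemma symdiff_iter_fwd_diff r h g x : symdiff r h (cst 1) g x =
  if (x + r%:R / 2 * h \in `[0, 1]) && (x - r%:R / 2 * h \in `[0, 1])
  then iter r (fwd_diff h) g (x - r%:R / 2 * h) else 0.
Proof.
rewrite /symdiff /= mulr1; case: ifP => // _; rewrite iter_fwd_diffE.
by apply: eq_bigr => k _; congr (_ * g _); field.
Qed.

(** The threshold t is free: steps h <= t use the r-th derivative, larger steps
    only the sup norm.  Both bounds are monotone in h, so they are worst at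
    h = t. *)
Lemma holder_norm_le r a t A B (u : nat -> R -> R) : (0 < r)%N -> 0 <= a <= r%:R ->
  0 < t -> deriv_chain r 0 1 u ->
  (forall x, I01 x -> `|u 0%N x| <= A) -> (forall x, I01 x -> `|u r x| <= B) ->
  (holder_norm r a (u 0%N) <= (A + (t `^ (r%:R - a) * B + t `^ (- a) * (2 ^+ r * A)))%:E)%E.
Proof.
move=> r0 /andP[a0 ar] t0 du uA uB.
have I0 : @I01 R 0 by rewrite I01E lexx ler01.
have A0 : 0 <= A by apply: le_trans (uA 0 I0).
have B0 : 0 <= B by apply: le_trans (uB 0 I0).
set Z := _ + t `^ (- a) * _.
have Z1 : t `^ (r%:R - a) * B <= Z by rewrite lerDl !mulr_ge0 ?powR_ge0 ?exprn_ge0.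
have Z2 : t `^ (- a) * (2 ^+ r * A) <= Z by rewrite lerDr mulr_ge0 ?powR_ge0.
rewrite EFinD; apply: leeD; first exact/normI_le.
apply: ge_ereal_sup => _ [h /= /andP[h0 h1] <-].
have ha0 : 0 < h `^ a by exact: powR_gt0.
suff hZ : (normI (symdiff r h (cst 1%R) (u 0%N)) <= (h `^ a * Z)%:E)%E.
  apply: le_trans (lee_wpmul2l _ hZ) _; first by rewrite lee_fin powR_ge0.
  by rewrite -EFinM lee_fin powRN mulrA mulVf ?gt_eqF// mul1r.
apply/normI_le => x Ix; rewrite symdiff_iter_fwd_diff.
have Z0 : 0 <= Z by apply: le_trans Z1; rewrite mulr_ge0 ?powR_ge0.
case: ifP => [|_]; last by rewrite normr0 mulr_ge0// ltW.
rewrite !in_itv /=; set y := x - _ => /andP[/andP[_ yh1] /andP[y0 _]].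
have {}yh1 : y + r%:R * h <= 1.
  by rewrite (_ : y + r%:R * h = x + r%:R / 2 * h)// /y; field.
have [ht|th] := leP h t.
  have ch := deriv_chainS y0 yh1 du.
  rewrite -(prednK r0) in ch.
  have [xi] := deriv_chain_MVT h0 ch.
  rewrite (prednK r0) => xi_in ->.
  rewrite normrM ger0_norm ?exprn_ge0 ?(ltW h0)//.
  have Ixi : I01 xi by rewrite I01E; clear -xi_in y0 yh1; lra.
  rewrite -powR_mulrn ?(ltW h0)//.
  rewrite (_ : h `^ r%:R = h `^ a * h `^ (r%:R - a)); last first.
    by rewrite -powRD ?subrKC ?(gt_eqF h0) ?implybT.
  rewrite -mulrA ler_pM2l//; apply: le_trans Z1.
  apply: ler_pM; rewrite ?powR_ge0 ?uB//.
  by apply: ge0_ler_powR; rewrite ?subr_ge0 ?nnegrE ?(ltW h0) ?(ltW t0).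
have bnd : `|iter r (fwd_diff h) (u 0%N) y| <= 2 ^+ r * A.
  apply: norm_iter_fwd_diff_le; first exact: ltW.
  by move=> z z_in; apply: uA; rewrite I01E; clear -z_in y0 yh1; lra.
apply: (le_trans bnd); apply: le_trans (ler_wpM2l (ltW ha0) Z2).
have ht1 : 1 <= h `^ a * t `^ (- a).
  rewrite powRN ler_pdivlMr ?powR_gt0// mul1r.
  by apply: ge0_ler_powR; rewrite ?nnegrE ?(ltW h0) ?(ltW t0) ?(ltW th).
rewrite [leRHS]mulrA; apply: ler_peMl ht1.
by rewrite mulr_ge0 ?exprn_ge0.
Qed.
End hoelder.

Theorem theorem6p3 (R : realType) (r : nat) (alpha gamma : R)
  (alpha_gt0 : 0 < alpha) (alpha_le_r : alpha <= r%:R) (gamma_ge0 : 0 <= gamma) :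
  exists C : R, forall (f : R -> R), CI r f ->
    forall n : nat, (r ^ 2 + 1 <= n)%N ->
    (holder_norm r alpha (fun x => f x - bernstein n f x)%R <=
      (1 / n%:R `^ (gamma * (r%:R - alpha)))%:E *
        (C%:E * omega2_phi (derivIn r f) (1 / Num.sqrt n%:R)%R
         + omega1 (derivIn r f) (r%:R / n%:R)%R
         + ((r%:R - 1) ^+ 2 / n%:R)%:E * normI (derivIn r f))
      + (C * n%:R `^ (gamma * alpha))%:E * omega2_phi f (1 / Num.sqrt n%:R)%R)%E.
Proof.
have r0 : (0 < r)%N by rewrite -(ltr0n R) (lt_le_trans alpha_gt0).
(* 9 comes from the direct estimate; 2^r and 1 from large steps and the sup norm *)
exists (9 * (2 ^+ r + 1)) => f Cf n rn.
have n0 : (0 < n)%N by rewrite addn1 in rn; exact: leq_ltn_trans rn.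
have nR : 0 < n%:R :> R by rewrite ltr0n.
have [df cF] := Cf.
have cf : {within I01, continuous f} := derivableI_continuous (df 0%N r0).
have [Kf fK] := continuous_bounded01 cf.
have [KF FK] := continuous_bounded01 cF.
have d0 : 0 <= 1 / Num.sqrt n%:R :> R by rewrite divr_ge0 ?sqrtr_ge0.
have d1 : 0 < r%:R / n%:R :> R by rewrite divr_gt0 ?ltr0n.
have [w2f w2f0 w2fE] := omega2_phi_fin d0 fK.
have [w2F w2F0 w2FE] := omega2_phi_fin d0 FK.
have [w1F w1F0 w1FE] := omega1_fin d1 FK.
have [NF NF0 NFE] := normI_fin FK.
pose u k := derivIn k f - bern_derivn n (fun k => f (k%:R / n%:R)) k.
have u0E : u 0%N = fun x => f x - bernstein n f x.
  apply/funext => x; rewrite /u !fctE bernsteinE /bern_derivn ffactn0 mul1r subn0.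
  by [].
have u0A x : I01 x -> `|u 0%N x| <= 9 * w2f.
  rewrite u0E bernsteinE I01E => Ix.
  have nn : (n <= n.*2)%N by rewrite -addnn leq_addr.
  exact: (bern_approx n0 nn w2f0 Ix cf (fun y s => omega2_phi_ge n0 w2fE)).
have urB x : I01 x -> `|u r x| <= 9 * w2F + w1F + (r%:R - 1) ^+ 2 / n%:R * NF.
  rewrite I01E => Ix; apply: bern_deriv_approx => //.
  - by apply/normI_le; rewrite NFE.
  - by move=> y z; exact: omega1_ge.
  - by move=> y s; exact: omega2_phi_ge.
have chain_u : deriv_chain r 0 1 u.
  by apply: deriv_chainB; [exact: CI_deriv_chain|exact: bern_deriv_chain].
(* the threshold for which the powers of t are those of n in the statement *)
pose t : R := n%:R `^ (- gamma).
have t0 : 0 < t by exact: powR_gt0.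
have a0r : 0 <= alpha <= r%:R by rewrite (ltW alpha_gt0).
rewrite -u0E; apply: le_trans (holder_norm_le r0 a0r t0 chain_u u0A urB) _.
rewrite w2fE w2FE w1FE NFE; do 3! rewrite -?EFinM -?EFinD; rewrite lee_fin.
have -> : t `^ (r%:R - alpha) = 1 / n%:R `^ (gamma * (r%:R - alpha)).
  by rewrite /t -powRrM mulNr powRN div1r.
have -> : t `^ (- alpha) = n%:R `^ (gamma * alpha) by rewrite /t -powRrM mulrNN.
set P := 1 / _; set Q := _ `^ (gamma * alpha).
have P0 : 0 <= P by rewrite divr_ge0 ?powR_ge0.
have Q1 : 1 <= Q.
  rewrite -[leLHS](powRr0 n%:R); apply: ler_powR; first by rewrite ler1n.
  by rewrite mulr_ge0// ltW.
have e0 : 0 <= 2 ^+ r :> R by rewrite exprn_ge0.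
have h1 : 0 <= P * (9 * 2 ^+ r * w2F) by rewrite !mulr_ge0.
have h2 : 0 <= (Q - 1) * (9 * w2f) by rewrite !mulr_ge0 ?subr_ge0.
clearbody P Q; lra.
Qed.
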